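(* Let $X \subset \mathbb{Z}^2$. Let $S$ be a member of a set of minimal bounding curves for $X$. Let $a \in S$ be the vertex of an interior angle, with measure $45^{\circ}$ ($\pi/4$ radians), formed by edges $E_1$ and $E_2$ of $S$. Let $p \in E_1$ be $c_2$-adjacent to $a$. Let $X$ be slant-thick at $p$. Let $A$ be a freezing set or a cold set for $(X,c_2)$. Then $a \in A$.
   Context: Adjacencies in $\mathbb{Z}^2$: distinct points $(x_1,x_2)$, $(y_1,y_2)$ are $c_2$-adjacent if $|x_i-y_i|\le 1$ for $i=1,2$; they are $c_1$-adjacent if moreover they differ in exactly one coordinate. For $\kappa\in\{c_1,c_2\}$ and $X\subset\mathbb{Z}^2$: a $\kappa$-path of length $k$ is a sequence $x_0,\dots,x_k$ with consecutive points equal or $\kappa$-adjacent; a set is $\kappa$-connected if any two of its points are joined by a $\kappa$-path in it; $d_\kappa(x,y)$ is the minimal length of a $\kappa$-path in $X$ from $x$ to $y$. $f:X\to X$ is in $C(X,\kappa)$ (is $\kappa$-continuous) if $\kappa$-adjacent points have equal or $\kappa$-adjacent images. $A\subset X$ is a freezing set for $(X,\kappa)$ if every $f\in C(X,\kappa)$ with $f|_A=\mathrm{id}_A$ equals $\mathrm{id}_X$. For $(X,\kappa)$ connected, $A\subset X$ is a cold set if every $f\in C(X,\kappa)$ with $f|_A=\mathrm{id}_A$ satisfies $d_\kappa(x,f(x))\le 1$ for all $x\in X$. A $c_2$-closed curve is a $c_2$-path $\{s_i\}_{i=0}^m$ with $s_0=s_m$ and $s_i\ne s_j$ whenever $0<|i-j|<m$.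 If $S\subset\mathbb{Z}^2$ is a $c_2$-closed curve such that $\mathbb{Z}^2\setminus S$ has two $c_1$-components, one finite and the other infinite, these are denoted $Int(S)$ and $Ext(S)$ respectively; then $D=S\cup Int(S)$ is a digital disk and $S$ is a bounding curve of $D$. Let $X\subset\mathbb{Z}^2$ be finite and $c_i$-connected, $i\in\{1,2\}$. A set of bounding curves of $X$ is a set of pairwise disjoint $c_2$-closed curves $S_1,\dots,S_n\subset X$ such that: $X\subset S_1\cup Int(S_1)$; for $j>1$, $D_j=S_j\cup Int(S_j)$ is a digital disk; no two of $S_1\cup Ext(S_1),D_2,\dots,D_n$ are $c_1$-adjacent or $c_2$-adjacent; and $\mathbb{Z}^2\setminus X=Ext(S_1)\cup\bigcup_{j=2}^n Int(S_j)$. A bounding curve of a disk $D$ is minimal if no bounding curve of $D$ has fewer points; a set of bounding curves of $X$ consists of minimal bounding curves if no $S_j$ can be replaced by a closed curve with fewer points so that the result is still a set of bounding curves of $X$. A digital line segment is a ($c_1$- or $c_2$-)connected collinear set of more than one point of $\mathbb{Z}^2$; it is horizontal or vertical (axis-parallel) or has slope $\pm1$ (slanted). The edges (sides) of a bounding curve $S$ are the maximal digital line segments in $S$. If edges $E_1,E_2$ of $S$ satisfy $E_1\cap E_2=\{p\}$, the interior angle at $p$ is the angle formed by $E_1$ and $E_2$ on the side of $S$ on which $X$ lies (i.e. the side of $Int(S)$ when $X$ is a digital disk bounded by $S$, or when $S=S_1$; the side of $Ext(S_j)$ when $S=S_j$, $j>1$); $p$ is its vertex. Slant-thickness: let $p$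 lie in a maximal slanted segment $\sigma$ of $S$ and not be an endpoint of $\sigma$. $X$ is slant-thick at $p$ if there exists $c\in X$ that is $c_2$-adjacent but not $c_1$-adjacent to $p$, where $c$ is the diagonal neighbor of $p$ off $\sigma$ (in the direction perpendicular to $\sigma$), on the side of $\sigma$ of the interior angle (the side on which $X$ lies). (Thus in this statement $E_1$ is the slanted edge.) *)

(* Defs.v *)
From HB Require Import structures.
From mathcomp Require Import all_boot all_order all_algebra finmap.
From mathcomp Require Import boolp classical_sets functions cardinality.
Set Implicit Arguments.
Unset Strict Implicit.
Unset Printing Implicit Defensive.
Import Order.TTheory GRing.Theory Num.Theory.
Local Open Scope classical_set_scope.
Local Open Scope ring_scope.

Notation pt := (int * int)%type.

Inductive adjacency := C1 | C2.

Definition adj (K : adjacency) (x y : pt) : bool :=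
  [&& x != y, `|x.1 - y.1| <= 1, `|x.2 - y.2| <= 1 &
      if K is C1 then (x.1 != y.1) (+) (x.2 != y.2) else true].

Definition adjeq (K : adjacency) (x y : pt) : bool := (x == y) || adj K x y.

Definition kpath (K : adjacency) (Y : set pt) (x y : pt) (n : nat) : Prop :=
  exists s : nat -> pt,
    [/\ s 0%N = x, s n = y,
        forall i, (i <= n)%N -> Y (s i) &
        forall i, (i < n)%N -> adjeq K (s i) (s i.+1)].

Definition connected (K : adjacency) (Y : set pt) : Prop :=
  forall x y, Y x -> Y y -> exists n, kpath K Y x y n.

(* The default value 0 is only reached when no K-path in X joins x to y. *)
Definition dist (K : adjacency) (X : set pt) (x y : pt) : nat :=
  xget 0%N [set n | kpath K X x y n /\ forall m, kpath K X x y m -> (n <= m)%N].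

(* A self-map of X is represented by a map on Z^2 that sends X into X; its
   values off X are irrelevant. *)
Definition cont_self (K : adjacency) (X : set pt) (f : pt -> pt) : Prop :=
  (forall x, X x -> X (f x)) /\
  (forall x y, X x -> X y -> adj K x y -> adjeq K (f x) (f y)).

Definition freezing_set (K : adjacency) (X A : set pt) : Prop :=
  A `<=` X /\
  forall f, cont_self K X f -> (forall x, A x -> f x = x) ->
  forall x, X x -> f x = x.

Definition cold_set (K : adjacency) (X A : set pt) : Prop :=
  [/\ connected K X, A `<=` X &
      forall f, cont_self K X f -> (forall x, A x -> f x = x) ->
      forall x, X x -> (dist K X x (f x) <= 1)%N].

Definition closed_curve (S : set pt) : Prop :=
  exists (m : nat) (s : nat -> pt),
    [/\ s 0%N = s m,
        forall i, (i < m)%N -> adjeq C2 (s i) (s i.+1),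
        forall i j, (i < j <= m)%N -> (j - i < m)%N -> s i <> s j &
        S = [set s i | i in [set i | (i <= m)%N]]].

Definition component (K : adjacency) (Y C : set pt) : Prop :=
  exists2 x, Y x & C = [set y | exists n, kpath K Y x y n].

Definition two_sided (S : set pt) : Prop :=
  exists I E, [/\ finite_set I, infinite_set E &
                  [set C | component C1 (~` S) C] = [set I; E]].

Definition Int (S : set pt) : set pt :=
  \bigcup_(C in [set C | component C1 (~` S) C /\ finite_set C]) C.

Definition Ext (S : set pt) : set pt :=
  \bigcup_(C in [set C | component C1 (~` S) C /\ infinite_set C]) C.

(* In a family of bounding curves, index [ord0] is the outer curve and the
   other indices are the curves around the holes.  [off S j] is the
   complementary region of [S j] on the side away from X. *)
Definition off (n : nat) (S : 'I_n.+1 -> set pt) (j : 'I_n.+1) : set pt :=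
  if j == ord0 then Ext (S j) else Int (S j).

Definition bounding_curves (X : set pt) (n : nat) (S : 'I_n.+1 -> set pt) :
  Prop :=
  [/\ forall j, [/\ closed_curve (S j), two_sided (S j) & S j `<=` X],
      forall j k, j != k -> S j `&` S k = set0,
      X `<=` S ord0 `|` Int (S ord0),
      forall j k, j != k -> forall (K : adjacency) x y,
        (S j `|` off S j) x -> (S k `|` off S k) y -> ~~ adj K x y &
      ~` X = \bigcup_j off S j].

Definition minimal_bounding_curves (X : set pt) (n : nat)
    (S : 'I_n.+1 -> set pt) : Prop :=
  bounding_curves X S /\
  forall (j : 'I_n.+1) (S' : set pt), closed_curve S' ->
    (#|` fset_set S'| < #|` fset_set (S j)|)%N ->
    ~ bounding_curves X (fun k => if k == j then S' else S k).

Definition collinear (E : set pt) : Prop :=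
  exists a b c : int, (a, b) <> (0, 0) /\
    forall x, E x -> a * x.1 + b * x.2 = c.

Definition segment (E : set pt) : Prop :=
  [/\ exists K, connected K E, collinear E &
      exists x y, [/\ E x, E y & x <> y]].

Definition edge (S E : set pt) : Prop :=
  [/\ segment E, E `<=` S &
      forall E', segment E' -> E' `<=` S -> E `<=` E' -> E' = E].

Definition slanted (E : set pt) : Prop :=
  forall x y, E x -> E y -> `|x.1 - y.1| = `|x.2 - y.2|.

(* The eight directions, numbered counterclockwise: [dir k] points at k * 45
   degrees from the positive first axis. *)
Definition dir (k : 'Z_8) : pt :=
  nth (0, 0) [:: (1, 0); (1, 1); (0, 1); (-1, 1);
                 (-1, 0); (-1, -1); (0, -1); (1, -1)] k.

(* The direction obtained from [dir i] by turning by k * 45 degrees,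
   counterclockwise if [ccw], clockwise otherwise. *)
Definition turn (ccw : bool) (i : 'Z_8) (k : nat) : 'Z_8 :=
  if ccw then i + k%:R else i - k%:R.

(* The edges E1 and E2 meet exactly in a, and their interior angle at a
   measures deg degrees; [ccw] tells in which sense this angle sweeps from E1
   to E2.  [F] is the complementary region (exterior or hole) of the curve on
   the side away from X.  Which of the two angular sectors at a is the one on
   the side of X is read off the C1-neighbours of a (regions are
   C1-components): none of those strictly inside the sector is in F, and those
   strictly inside the opposite sector are in F.  Orientation of the curve
   alone would not do: a minimal bounding curve may have to wind through a part
   of X, and at such turns X lies on both sides of it. *)
Definition interior_angle (F E1 E2 : set pt) (a : pt) (ccw : bool)
    (deg : nat) : Prop :=
  E1 `&` E2 = [set a] /\
  exists (i : 'Z_8) (n : nat),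
    [/\ (0 < n < 8)%N, deg = (45 * n)%N,
        E1 (a + dir i), E2 (a + dir (turn ccw i n)) &
        forall k, (k < 8)%N -> adj C1 a (a + dir (turn ccw i k)) ->
          ((0 < k < n)%N -> ~ F (a + dir (turn ccw i k))) /\
          ((n < k)%N -> F (a + dir (turn ccw i k)))].

(* The open half-plane to the left ([ccw]) or right of the line from a to p. *)
Definition half_plane (a p : pt) (ccw : bool) : set pt :=
  [set c | let t := (p.1 - a.1) * (c.2 - a.2) - (p.2 - a.2) * (c.1 - a.1) in
           if ccw then 0 < t else t < 0].

Definition endpoint (E : set pt) (p : pt) : Prop :=
  E p /\ forall d : 'Z_8, ~ (E (p + dir d) /\ E (p - dir d)).

(* X is slant-thick at the point p of the maximal slanted segment sigma of S,
   where H is the side of sigma on which the interior angle lies. *)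
Definition slant_thick (X S sigma : set pt) (p : pt) (H : set pt) : Prop :=
  [/\ edge S sigma, slanted sigma, sigma p, ~ endpoint sigma p &
      exists c, [/\ X c, adj C2 p c, ~~ adj C1 p c, ~ sigma c & H c]].

(* Main.v *)
(** The vertex [a] has a single C1-neighbour [b] outside the complementary region
    F beyond the curve S, and F is C1-connected.  If a point [x] of X were
    C2-adjacent to [a] but not to the point [c = a + 2 (b - a)], then [x] would be
    a diagonal neighbour of [a] lying on S, between two C1-neighbours of [a] in F.
    Joining these by a path in F and closing it up through [a] gives a loop
    separating [x] from the next point of the slanted edge; but S is a simple
    closed curve, so S minus [a] joins those two points without meeting the loop.
    Hence every C2-neighbour of [a] in X is also a neighbour of [c], and
    slant-thickness says that [c] is in X.  The map moving [a] to [c] and fixing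
    all other points is therefore C2-continuous and moves [a] by more than 1. *)

Require Import Defs.
From HB Require Import structures.
From mathcomp Require Import all_boot all_order all_algebra finmap.
From mathcomp Require Import boolp classical_sets functions cardinality.
From mathcomp Require Import zify.
Set Implicit Arguments.
Unset Strict Implicit.
Unset Printing Implicit Defensive.
Import Order.TTheory GRing.Theory Num.Theory.
Local Open Scope classical_set_scope.
Local Open Scope ring_scope.

(** * Translations and adjacency in the plane *)

Lemma subrDD (u v w : int) : u + v - (u + w) = v - w.
Proof. lia. Qed.

Lemma adj_sym (K : adjacency) (x y : pt) : adj K x y -> adj K y x.
Proof.
rewrite /adj (distrC y.1) (distrC y.2).
by rewrite (eq_sym y) (eq_sym y.1) (eq_sym y.2).
Qed.

Lemma adjD (K : adjacency) (a x y : pt) : adj K (a + x) (a + y) = adj K x y.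
Proof.
by rewrite /adj (inj_eq (addrI a)) /= !subrDD !(inj_eq (addrI _)).
Qed.

Lemma adjeqD (K : adjacency) (a x y : pt) :
  adjeq K (a + x) (a + y) = adjeq K x y.
Proof. by rewrite /adjeq adjD (inj_eq (addrI a)). Qed.

Lemma adjeqC1_cases (x y : pt) : adjeq C1 x y ->
  exists2 e : pt, e \in [:: (0, 0); (1, 0); (-1, 0); (0, 1); (0, -1)] & y = x + e.
Proof.
move=> h; exists (y - x); last by rewrite addrC subrK.
move: h; case: x y => [x1 x2] [y1 y2].
by rewrite /adjeq /adj !inE -!pair_eqE /=; lia.
Qed.

Lemma adjeqC2_cases (x y : pt) : adjeq C2 x y ->
  exists2 e : pt, e \in [:: (0, 0); (1, 0); (-1, 0); (0, 1); (0, -1);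
     (1, 1); (1, -1); (-1, 1); (-1, -1)] & y = x + e.
Proof.
move=> h; exists (y - x); last by rewrite addrC subrK.
move: h; case: x y => [x1 x2] [y1 y2].
by rewrite /adjeq /adj !inE -!pair_eqE /=; lia.
Qed.

Lemma adj_diagonal (a u : pt) : adj C2 a u -> ~~ adj C1 a u ->
  exists2 e : pt, e \in [:: (1, 1); (1, -1); (-1, 1); (-1, -1)] & u = a + e.
Proof.
move=> h h'; exists (u - a); last by rewrite addrC subrK.
move: h h'; case: a u => [a1 a2] [u1 u2].
by rewrite /adj !inE -!pair_eqE /=; lia.
Qed.

Lemma adj_corners (a x : pt) : adj C2 a x -> ~~ adj C1 a x ->
  [/\ adj C1 a (x.1, a.2), adj C1 a (a.1, x.2),
      adj C1 x (x.1, a.2) & adj C1 x (a.1, x.2)].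
Proof.
case: a x => [a1 a2] [x1 x2] ax nax.
by split; move: ax nax; rewrite /adj -!pair_eqE /=; lia.
Qed.

(** With [g = b - a], the point [x] is [a + g + h] for a unit step [h] orthogonal to [g], so it
    differs from [a + 2g] by the diagonal step [g - h]. *)
Lemma double_step_adj (a b x : pt) : adj C1 a b ->
  adj C2 a x -> ~~ adj C1 a x -> adj C1 x b -> adjeq C2 (b + (b - a)) x.
Proof.
move=> ab ax nax xb; have [e he xE] := adj_diagonal ax nax.
have [|g hg bE] := @adjeqC1_cases a b; first by rewrite /adjeq ab orbT.
move: xb; rewrite {}xE {}bE.
case: a {ab ax nax} => [a1 a2]; rewrite !inE in he hg.
(do ?[case/orP: he => he]; move/eqP: he => ->);
(do ?[case/orP: hg => hg]; move/eqP: hg => ->);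
rewrite /adjeq /adj -!pair_eqE /=.
all: lia.
Qed.

(** * Winding parity and separation *)

(* Whether the step from [s] to [t] crosses the ray going right from [z], shifted
   up by 1/2.  Modulo 2, the number of crossings of a closed C1-path is the
   winding number around [z]. *)
Definition crossing (z s t : pt) : bool :=
  (z.1 < s.1) && ((z.2 < s.2) (+) (z.2 < t.2)).

(* The part right of the upper of [z] and [z'] of its row: the region between the
   rays of [z] and [z'], for C2-adjacent [z] and [z']. *)
Definition half_row (z z' s : pt) : bool :=
  [&& z.2 < s.2, s.2 <= z'.2 & z'.1 < s.1]
  || [&& z'.2 < s.2, s.2 <= z.2 & z.1 < s.1].

(** The two rays bound [half_row z z'] up to a gap at [z] and [z'], which a step avoiding both
    points cannot use. So a step crosses exactly one ray when it enters or leaves this region. *)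
Lemma crossing_step (z z' s t : pt) :
  adjeq C2 z z' -> adjeq C1 s t ->
  s != z -> s != z' -> t != z -> t != z' ->
  crossing z s t (+) crossing z' s t = half_row z z' s (+) half_row z z' t.
Proof.
move=> /adjeqC2_cases [e he ->] /adjeqC1_cases [g hg ->].
case: z s => [z1 z2] [s1 s2].
rewrite !inE in he hg.
(do ?[case/orP: he => he]; move/eqP: he => ->);
(do ?[case/orP: hg => hg]; move/eqP: hg => ->);
rewrite /crossing /half_row -!pair_eqE /=.
all: lia.
Qed.

Definition crossings (z : pt) (s : nat -> pt) (n : nat) : bool :=
  \big[addb/false]_(i < n) crossing z (s i) (s i.+1).

(** The contributions of [crossing_step] telescope. *)
Lemma crossings_step (z z' : pt) (Y : set pt) (s : nat -> pt) (n : nat) :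
  adjeq C2 z z' -> ~ Y z -> ~ Y z' ->
  (forall i, (i <= n)%N -> Y (s i)) ->
  (forall i, (i < n)%N -> adjeq C1 (s i) (s i.+1)) ->
  crossings z s n (+) crossings z' s n
  = half_row z z' (s 0%N) (+) half_row z z' (s n).
Proof.
move=> zz' Yz Yz'; rewrite /crossings.
have neqY x y : Y x -> ~ Y y -> x != y.
  by move=> Yx nYy; apply: contra_not_neq nYy => <-.
elim: n => [|n IHn] Ys adjs; first by rewrite !big_ord0 !addbb.
rewrite !big_ord_recr /= addbACA IHn; last first.
- by move=> i lin; apply: adjs; lia.
- by move=> i lin; apply: Ys; lia.
rewrite crossing_step ?adjs //; try by apply: neqY => //; apply: Ys.
by rewrite -addbA; congr (_ (+) _); rewrite addbA addbb.
Qed.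

(* At an interior occurrence [l] of [a], no other index is sent to [a], so [i]
   and [j] are joined around the other way, through [s 0 = s m]. *)
Lemma closed_curve_const (S : set pt) (a : pt) (P : pt -> bool) :
  closed_curve S ->
  (forall x y, S x -> S y -> x <> a -> y <> a -> adjeq C2 x y -> P x = P y) ->
  forall x y, S x -> S y -> x <> a -> y <> a -> P x = P y.
Proof.
move=> [m [s [s0m adjs injs ->]]] Pstep.
have mem i : (i <= m)%N -> [set s i | i in [set i | (i <= m)%N]] (s i).
  by move=> lim; exists i.
have Pseg i j : (i <= j <= m)%N -> (forall k, (i <= k <= j)%N -> s k <> a) ->
    P (s i) = P (s j).
  elim: j => [|j IHj] ijm nota; first by have -> : i = 0%N by lia.
  have [-> //|neq_ij] := eqVneq i j.+1.
  rewrite IHj; [|lia|by move=> k kij; apply: nota; lia].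
  apply: Pstep; [apply: mem; lia|apply: mem; lia|apply: nota; lia| |].
    by apply: nota; lia.
  by apply: adjs; lia.
move=> _ _ [i /= lim <-] [j /= ljm <-].
wlog leij : i j lim ljm / (i <= j)%N.
  move=> W ia ja; case: (leqP i j) => [/W|/ltnW /W h]; first exact.
  by apply/esym/h.
move=> ia ja.
have [/existsP [l /andP[lij /eqP la]]|none] :=
    boolP [exists l : 'I_m.+1, (i <= l <= j)%N && (s l == a)].
  have li : (i : nat) != l by apply/eqP => E; rewrite E la in ia.
  have lj : (j : nat) != l by apply/eqP => E; rewrite E la in ja.
  rewrite -(Pseg 0%N i); last 2 first.
  - lia.
  - by move=> k ki; rewrite -la; apply: injs; lia.
  rewrite s0m (Pseg j m) //; first by lia.
  by move=> k kj ka; apply: (injs l k); [lia|lia|rewrite la ka].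
apply: Pseg; first by lia.
move=> k kij ka; move/negP: none; apply; apply/existsP.
have lk : (k < m.+1)%N by lia.
by exists (Ordinal lk); rewrite /= kij ka eqxx.
Qed.

(** For a path from [w1] to [w2] avoiding [u], [v] and [a], [crossings_step] makes the right-hand
    side the difference of its crossing parities at [u] and [v]. The inequality thus says that the
    loop closed up through [a] has different winding parities around them. *)
Lemma crossing_corner (a u v : pt) :
  adj C2 a u -> ~~ adj C1 a u -> adj C2 a v -> ~~ adj C1 a v -> u <> v ->
  let w1 := (u.1, a.2) in let w2 := (a.1, u.2) in
  (crossing u a w1 (+) crossing u w2 a) (+) (crossing v a w1 (+) crossing v w2 a)
  != (half_row u a w1 (+) half_row u a w2)
     (+) (half_row v a w1 (+) half_row v a w2).
Proof.
move=> au nau av nav.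
have [e he ->] := adj_diagonal au nau; have [g hg ->] := adj_diagonal av nav.
move/eqP; case: a {au nau av nav} => [a1 a2].
rewrite !inE in he hg.
(do ?[case/orP: he => he]; move/eqP: he => ->);
(do ?[case/orP: hg => hg]; move/eqP: hg => ->);
rewrite /crossing /half_row -!pair_eqE /=.
all: lia.
Qed.

(* Closing the path up at [a] gives a loop that separates [u] from every other
   diagonal neighbour [v] of [a]; [S] minus [a] would connect them. *)
Lemma closed_curve_pinch (S : set pt) (a u v : pt) (n : nat) :
  closed_curve S -> S a -> S u -> S v -> u <> v ->
  adj C2 a u -> ~~ adj C1 a u -> adj C2 a v -> ~~ adj C1 a v ->
  ~ kpath C1 (~` S) (u.1, a.2) (a.1, u.2) n.
Proof.
move=> cS Sa Su Sv uv au nau av nav [s [s0 sn sS adjs]].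
pose w1 : pt := (u.1, a.2); pose w2 : pt := (a.1, u.2).
(* The winding parity around [z] of the loop from [a] to [w1], along [s] to [w2], and back to
   [a]. *)
pose P z := crossings z s n (+) (crossing z a w1 (+) crossing z w2 a).
have notS z : S z -> ~ (~` S) z by move=> ? /(_ _).
have ua : u <> a by move: au => /and4P[/eqP ? _ _ _]; exact/nesym.
have va : v <> a by move: av => /and4P[/eqP ? _ _ _]; exact/nesym.
have Sw1 : ~ S w1 by rewrite /w1 -s0; apply: sS.
have Sw2 : ~ S w2 by rewrite /w2 -sn; apply: sS.
have neqS x y : S x -> ~ S y -> y != x.
  by move=> Sx; apply: contra_not_neq => ->.
have aw1 : adjeq C1 a w1.
  move: au nau; rewrite /w1 /adjeq /adj -!pair_eqE /=; lia.
have aw2 : adjeq C1 w2 a.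
  move: au nau; rewrite /w2 /adjeq /adj -!pair_eqE /=; lia.
(* Neighbouring points of [S] other than [a] are off the loop, so the [half_row] terms of its three
   pieces cancel. *)
have Puv : P u = P v.
  apply: (closed_curve_const cS (a := a)) => // x y Sx Sy xa ya xy.
  have := crossings_step xy (notS _ Sx) (notS _ Sy) sS adjs.
  have := crossing_step xy aw1 (introN eqP (nesym xa)) (introN eqP (nesym ya))
    (neqS _ _ Sx Sw1) (neqS _ _ Sy Sw1).
  have := crossing_step xy aw2 (neqS _ _ Sx Sw2) (neqS _ _ Sy Sw2)
    (introN eqP (nesym xa)) (introN eqP (nesym ya)).
  rewrite /P s0 sn -/w1 -/w2.
  case: (half_row x y a); case: (half_row x y w1); case: (half_row x y w2);
  case: (crossing x a w1); case: (crossing y a w1);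
  case: (crossing x w2 a); case: (crossing y w2 a) => //= _ _;
  by case: (crossings x s n); case: (crossings y s n).
(* The open path [s] misses [a] too, so its counts at [u] and [v] can both be compared with that at
   [a]. *)
have Pa z : S z -> adj C2 a z -> crossings z s n (+) crossings a s n
    = half_row z a w1 (+) half_row z a w2.
  move=> Sz az; rewrite (crossings_step (Y := ~` S)) ?s0 ?sn //.
  by move: az; rewrite /adjeq /adj -!pair_eqE /=; lia.
have := Pa u Su au; have := Pa v Sv av; move: Puv; rewrite /P.
have := crossing_corner au nau av nav uv; rewrite /= -/w1 -/w2.
case: (crossing u a w1); case: (crossing u w2 a); case: (crossing v a w1);
case: (crossing v w2 a); case: (half_row u a w1); case: (half_row u a w2);
case: (half_row v a w1); case: (half_row v a w2) => //= _;
by case: (crossings u s n); case: (crossings v s n); case: (crossings a s n).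
Qed.

(** * Paths, components and distance *)

Lemma kpath_sym (K : adjacency) (Y : set pt) (x y : pt) (n : nat) :
  kpath K Y x y n -> kpath K Y y x n.
Proof.
move=> [s [s0 sn sY adjs]]; exists (fun i => s (n - i)%N); split.
- by rewrite subn0.
- by rewrite subnn.
- by move=> i _; apply: sY; lia.
move=> i lin; have lt : (n - i.+1 < n)%N by lia.
have := adjs _ lt; have -> : (n - i.+1).+1 = (n - i)%N by lia.
by rewrite /adjeq eq_sym => /predU1P[->|/adj_sym ->]; rewrite ?eqxx ?orbT.
Qed.

Lemma kpath_trans (K : adjacency) (Y : set pt) (x y z : pt) (m n : nat) :
  kpath K Y x y m -> kpath K Y y z n -> kpath K Y x z (m + n).
Proof.
move=> [s [s0 sm sY adjs]] [t [t0 tn tY adjt]].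
exists (fun i => if (i < m)%N then s i else t (i - m)%N); split.
- case: ltnP => // m0; have m_eq : m = 0%N by lia.
  by rewrite m_eq subnn t0 -sm m_eq s0.
- by rewrite ltnNge leq_addr /= addnC addnK.
- move=> i lei; case: ltnP => h; first by apply: sY; lia.
  by apply: tY; lia.
move=> i lti; case: ltnP => h.
  case: ltnP => h'; first exact: adjs.
  have e : i.+1 = m by lia.
  by rewrite e subnn t0 -sm -e; apply: adjs; lia.
by rewrite ltnNge leqW //= subSn //; apply: adjt; lia.
Qed.

Lemma kpath1 (K : adjacency) (Y : set pt) (x y : pt) :
  Y x -> Y y -> adjeq K x y -> kpath K Y x y 1.
Proof.
move=> Yx Yy xy; exists (fun i => if i is 0 then x else y); split => //.
- by case.
- by case.
Qed.

Lemma component_sub (K : adjacency) (Y C : set pt) : component K Y C -> C `<=` Y.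
Proof. by move=> [x Yx ->] y [n [s [_ <- sY _]]]; apply: sY. Qed.

Lemma component_adj (K : adjacency) (Y C : set pt) (x y : pt) :
  component K Y C -> C x -> Y y -> adj K x y -> C y.
Proof.
move=> CC; have Yx := component_sub CC; case: CC Yx => [z Yz ->] CY Cx Yy xy.
have [n zx] := Cx; exists (n + 1)%N; apply: kpath_trans zx _.
by apply: kpath1 => //; [apply: CY | rewrite /adjeq xy orbT].
Qed.

Lemma component_kpath (K : adjacency) (Y C : set pt) (x y : pt) :
  component K Y C -> C x -> C y -> exists n, kpath K Y x y n.
Proof.
move=> [z Yz ->] [m zx] [n zy]; exists (m + n)%N.
by apply: kpath_trans zy; apply: kpath_sym.
Qed.

(** There is just one finite and one infinite component, so the union defining [Int] or [Ext] has a
    single member. *)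
Lemma off_component (n : nat) (S : 'I_n.+1 -> set pt) (j : 'I_n.+1) :
  two_sided (S j) -> component C1 (~` S j) (off S j).
Proof.
move=> [I [E [finI infE eqIE]]].
have IE C : component C1 (~` S j) C <-> C = I \/ C = E.
  by rewrite -[component _ _ _]/([set C | component C1 (~` S j) C] C) eqIE.
have -> : off S j = if j == ord0 then E else I.
  rewrite /off /Ext /Int; case: eqP => _; apply/seteqP; split => x.
  - by move=> [C [/IE[] -> //]].
  - by move=> Ex; exists E => //; split => //; apply/IE; right.
  - by move=> [C [/IE[] -> //]].
  - by move=> Ix; exists I => //; split => //; apply/IE; left.
by apply/IE; case: eqP; [right|left].
Qed.

Lemma dist_gt1 (K : adjacency) (X : set pt) (x y : pt) :
  connected K X -> X x -> X y -> ~~ adjeq K x y -> (1 < dist K X x y)%N.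
Proof.
move=> cX Xx Xy nxy.
have exn : exists n, `[<kpath K X x y n>].
  by have [n h] := cX _ _ Xx Xy; exists n; apply/asboolP.
rewrite /dist; case: xgetP => [k _ [[s [s0 sk _ adjs]] _]|none].
  case: k s0 sk adjs => [|[|//]] s0 sk adjs.
    by move: nxy; rewrite -s0 -sk /adjeq eqxx.
  by move: nxy; rewrite -s0 -sk adjs.
(* The default value of [dist] does not occur: some path exists, hence a shortest one. *)
case: (ex_minnP exn) => k /asboolP hk mink.
by case: (none k); split=> // m hm; apply: mink; apply/asboolP.
Qed.

(** A C1-neighbour of [a] in [X] can only be [b], and a diagonal one next to [b] falls under
    [double_step_adj]. Any other would have both corners shared with [a] in [off S j], which
    [closed_curve_pinch] forbids in the presence of [v]. *)
Lemma single_gap_neighbors (X : set pt) (n : nat) (S : 'I_n.+1 -> set pt)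
    (j : 'I_n.+1) (a b v x : pt) :
  bounding_curves X S ->
  (forall y, adj C1 a y -> y <> b -> off S j y) ->
  adj C1 a b -> S j a -> S j v -> adj C2 a v -> ~~ adj C1 a v -> adj C1 v b ->
  X x -> adj C2 a x -> adjeq C2 (b + (b - a)) x.
Proof.
move=> [curves _ _ _ offX] offa ab Sa Sv av nav vb Xx ax.
have [cS tS _] := curves j.
have compF := off_component tS.
have notX y : off S j y -> ~ X y.
  by move=> Fy; have : (~` X) y by rewrite offX; exists j.
have [a1x|na1x] := boolP (adj C1 a x).
  have -> : x = b by apply: contrapT => xb; exact: (notX x (offa x a1x xb)).
  move: ab; clear; case: a b => [a1 a2] [b1 b2].
  by rewrite /adjeq /adj -!pair_eqE /=; lia.
have [xb|nxb] := boolP (adj C1 x b).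
  exact: double_step_adj ab ax na1x xb.
have [aw1 aw2 xw1 xw2] := adj_corners ax na1x.
have Fw1 : off S j (x.1, a.2) by apply: offa => // E; rewrite -E xw1 in nxb.
have Fw2 : off S j (a.1, x.2) by apply: offa => // E; rewrite -E xw2 in nxb.
(* Off the curve, [x] would belong to the same component as its neighbour [(x.1, a.2)], hence not to
   [X]. *)
have Sx : S j x.
  apply: contrapT => nSx.
  exact: (notX x (component_adj compF Fw1 nSx (adj_sym xw1))).
have xv : x <> v by move=> xv; move: nxb; rewrite xv vb.
have [m w1w2] := component_kpath compF Fw1 Fw2.
by case: (closed_curve_pinch cS Sa Sx Sv xv ax na1x av nav w1w2).
Qed.

(** * The eight directions *)

Lemma adj_dir (a y : pt) : adj C2 a y -> exists k : 'Z_8, y = a + dir k.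
Proof.
move=> ay; pose ds : seq pt := [:: (1, 0); (1, 1); (0, 1); (-1, 1);
                                   (-1, 0); (-1, -1); (0, -1); (1, -1)].
have yds : y - a \in ds.
  move: ay; case: a y => [a1 a2] [y1 y2].
  by rewrite /adj !inE -!pair_eqE /=; lia.
exists (inord (index (y - a) ds)); rewrite /dir inordK; last first.
  by rewrite (_ : 8 = size ds)%N // index_mem.
by rewrite nth_index // addrC subrK.
Qed.

Lemma turn_surj (ccw : bool) (i k : 'Z_8) :
  exists2 l, (l < 8)%N & turn ccw i l = k.
Proof.
exists (if ccw then k - i else i - k); first by case: ccw; apply: ltn_ord.
by rewrite /turn; case: ccw; rewrite natr_Zp; [rewrite addrC subrK|rewrite subKr].
Qed.

Lemma dir_slanted (i : 'Z_8) (ccw : bool) :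
  `|(dir i).1| = `|(dir i).2| ->
  let g := dir (turn ccw i 1) in
  [/\ adj C2 0 (dir i), ~~ adj C1 0 (dir i), adj C1 0 g & adj C1 (dir i) g].
Proof.
by case: ccw i => -[[|[|[|[|[|[|[|[|//]]]]]]]] ilt] //=; split; vm_compute.
Qed.

(** The strict half-plane rules out [d] parallel to [dir i] and selects one of the two perpendicular
    diagonals; the sum is then twice an axis step. *)
Lemma dir_slant_thick (i : 'Z_8) (ccw : bool) (d : pt) :
  `|(dir i).1| = `|(dir i).2| ->
  adj C2 0 d -> ~~ adj C1 0 d -> half_plane 0 (dir i) ccw (dir i + d) ->
  dir i + d = dir (turn ccw i 1) *+ 2.
Proof.
move=> sl d2 d1; have [e he ->] := adj_diagonal d2 d1; move: he sl.
rewrite !inE add0r /half_plane.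
case: ccw i => -[[|[|[|[|[|[|[|[|//]]]]]]]] ilt] //= he _;
(do ?[case/orP: he => he]; move/eqP: he => ->) => //=.
Qed.

(** The equations leave [dir k] equal or opposite to [dir i], and the opposite direction is too far
    from the doubled axis step. *)
Lemma dir_slant_unique (i k : 'Z_8) (ccw : bool) :
  `|(dir i).1| = `|(dir i).2| -> `|(dir k).1| = `|(dir k).2| ->
  `|(dir k).1 - (dir i).1| = `|(dir k).2 - (dir i).2| ->
  adjeq C2 (dir (turn ccw i 1) *+ 2) (dir k) -> dir k = dir i.
Proof.
case: ccw i k => -[[|[|[|[|[|[|[|[|//]]]]]]]] ?] -[[|[|[|[|[|[|[|[|//]]]]]]]] ?];
by vm_compute.
Qed.

Lemma dir_double_far (i : 'Z_8) : ~~ adjeq C2 0 (dir i *+ 2).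
Proof. by case: i => -[|[|[|[|[|[|[|[|//]]]]]]]] ?; vm_compute. Qed.

Lemma half_planeD (a x y z : pt) (ccw : bool) :
  half_plane (a + x) (a + y) ccw (a + z) = half_plane x y ccw z.
Proof.
by rewrite /half_plane /= !subrDD.
Qed.

Theorem proposition5p2 (X : set pt) (K : adjacency) (n : nat)
    (S : 'I_n.+1 -> set pt) (j : 'I_n.+1) (A E1 E2 : set pt) (a p : pt)
    (ccw : bool) :
  finite_set X -> connected K X ->
  minimal_bounding_curves X S ->
  edge (S j) E1 -> edge (S j) E2 ->
  interior_angle (off S j) E1 E2 a ccw 45 ->
  E1 p -> adj C2 a p ->
  slant_thick X (S j) E1 p (half_plane a p ccw) ->
  freezing_set C2 X A \/ cold_set C2 X A ->
  A a.
Proof.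
move=> _ _ [bcS _] [_ E1S _] [_ E2S _] [E12 [i [m [m_lt m45 E1v E2b hF]]]].
move=> E1p ap [_ slE1 _ _ [c [Xc pc npc _ hc]]] frz.
have m1 : m = 1%N by lia.
subst m.
have [E1a E2a] : (E1 `&` E2) a by rewrite E12.
set v := a + dir i in E1v; set b := a + dir (turn ccw i 1) in E2b.
have sl_i : `|(dir i).1| = `|(dir i).2|.
  by have := slE1 _ _ E1v E1a; rewrite -[a]addr0 /= !subrDD !subr0.
have [di1 di2 di3 di4] := dir_slanted ccw sl_i.
have av : adj C2 a v by rewrite -[a]addr0 adjD.
have nav : ~~ adj C1 a v by rewrite -[a]addr0 adjD.
have ab : adj C1 a b by rewrite -[a]addr0 adjD.
have vb : adj C1 v b by rewrite adjD.
have Sa : S j a by apply: E1S.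
have Sv : S j v by apply: E1S.
have SX x : S j x -> X x by case: bcS => /(_ j) [_ _ SjX] _ _ _ _; apply: SjX.
have offa y : adj C1 a y -> y <> b -> off S j y.
  move=> ay yb.
  have [k yE] : exists k, y = a + dir k.
    by apply: adj_dir; case/and4P: ay => ya y1 y2 _; apply/and4P; split.
  have [l l8 lE] := turn_surj ccw i k.
  (* Turn 0 gives the diagonal neighbour [v], turn 1 gives [b], and all further turns lie outside
     the 45 degree angle. *)
  rewrite yE -lE; case: l l8 lE => [|[|l]] l8 lE.
  - move: ay nav; rewrite yE -lE /turn.
    by case: (ccw); rewrite ?addr0 ?subr0 => ->.
  - by case: yb; rewrite yE -lE.
  - by apply: (hF l.+2 l8 _).2 => //; rewrite lE -yE.
have nbr x : X x -> adj C2 a x -> adjeq C2 (b + (b - a)) x.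
  exact: (single_gap_neighbors bcS offa ab Sa Sv av nav vb).
have c2E : b + (b - a) = a + dir (turn ccw i 1) *+ 2.
  by rewrite /b [a + _ - a]addrAC subrr add0r -addrA.
(* The point of [E1] opposite to [v] across [a] is also a candidate for [p]; [nbr] excludes it. *)
have pv : p = v.
  have [k pE] := adj_dir ap; rewrite pE; congr (a + _).
  have Xp : X p by apply/SX/E1S.
  have := nbr p Xp ap; rewrite pE c2E adjeqD.
  have := slE1 _ _ E1p E1v; rewrite pE /v /= !subrDD.
  have := slE1 _ _ E1p E1a; rewrite pE -{2 4}[a]addr0 /= !subrDD !subr0.
  exact: dir_slant_unique.
have cE : c = b + (b - a).
  have [d dE] : exists d, c = p + d by exists (c - p); rewrite addrC subrK.
  move: pc npc hc; rewrite c2E dE -{1 3}[p]addr0 !adjD pv /v -{1}[a]addr0 -addrA.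
  by rewrite half_planeD => pc npc hc; congr (a + _); apply: dir_slant_thick.
have nac : ~~ adjeq C2 a c by rewrite cE c2E -{1}[a]addr0 adjeqD dir_double_far.
pose f x := if x == a then c else x.
have contf : cont_self C2 X f.
  split=> [x Xx|x y Xx Xy xy]; rewrite /f; first by case: eqP.
  case: eqP => [xa|_]; case: eqP => [ya|_].
  - by rewrite /adjeq eqxx.
  - by rewrite cE; apply: nbr => //; rewrite -xa.
  - have := nbr x Xx; rewrite -cE => /(_ _)/predU1P[|->|/adj_sym h].
    + by rewrite -ya; apply: adj_sym.
    + by rewrite /adjeq eqxx.
    + by rewrite /adjeq h orbT.
  - by rewrite /adjeq xy orbT.
apply: contrapT => nAa.
have fA x : A x -> f x = x by rewrite /f; case: eqP => // -> /nAa.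
have Xa := SX a Sa; have fa : f a = c by rewrite /f eqxx.
case: frz => [[_ /(_ f contf fA a Xa)]|[cX _ /(_ f contf fA a Xa)]]; rewrite fa.
  by move=> ca; move: nac; rewrite ca /adjeq eqxx.
by rewrite leqNgt dist_gt1.
Qed.
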